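(* Let $\mathbb{K}$ be a field, $S=\mathbb{K}[x_1,\ldots,x_n]$ and $t\geq 1$ an integer. For any $t$-spread strongly stable ideal $I\subset S$, the $t$-spread lex ideal $I^{t\text{-lex}}$ exists; that is, there exists a $t$-spread lex ideal $J\subset S$ such that $\mathbf{f}_t(J)=\mathbf{f}_t(I)$.
   Context: A monomial $x_{i_1}x_{i_2}\cdots x_{i_d}\in S$ with $i_1\leq i_2\leq\cdots\leq i_d$ is called $t$-spread if $i_j-i_{j-1}\geq t$ for $2\leq j\leq d$. A monomial ideal of $S$ is a $t$-spread monomial ideal if it is generated by $t$-spread monomials. $M_{n,d,t}$ is the set of $t$-spread monomials of degree $d$ in $S$. For a monomial $u$, $\operatorname{supp}(u)=\{i: x_i\mid u\}$. The symbol $>_{\mathrm{lex}}$ is the lexicographic order with $x_1>x_2>\cdots>x_n$. A subset $L\subset M_{n,d,t}$ is a $t$-spread strongly stable set if for all $u\in L$, all $j\in\operatorname{supp}(u)$ and all $1\leq i<j$ such that $x_i(u/x_j)$ is a $t$-spread monomial, one has $x_i(u/x_j)\in L$. A subset $L\subset M_{n,d,t}$ is a $t$-spread lex set if for all $u\in L$ and all $v\in M_{n,d,t}$ with $v>_{\mathrm{lex}}u$, one has $v\in L$. For a monomial ideal $I$, $I_j$ is its $j$-th graded component and $[I_j]_t$ is the set of $t$-spread monomials in $I_j$. A $t$-spread monomial ideal $I$ is a $t$-spread strongly stable ideal (respectively a $t$-spread lex ideal) if $[I_j]_t$ is a $t$-spread strongly stable set (respectively a $t$-spread lex set) for all $j$.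 The $f_t$-vector of a $t$-spread monomial ideal $I$ is $\mathbf{f}_t(I)=(f_{t,-1}(I),f_{t,0}(I),\ldots,f_{t,j}(I),\ldots)$, where $f_{t,j-1}(I)=|[S_j]_t|-|[I_j]_t|$ for $j\ge 1$ and, by convention, $f_{t,-1}(I)=1$. The notation $I^{t\text{-lex}}$ denotes the $t$-spread lex ideal of $S$ with the same $f_t$-vector as $I$, if it exists. *)

(* Defs.v *)
From mathcomp Require Export all_boot all_order all_algebra.
From mathcomp.multinomials Require Export mpoly.

Set Implicit Arguments.
Unset Strict Implicit.
Unset Printing Implicit Defensive.

Import Order.TTheory GRing.Theory.

Local Open Scope ring_scope.

(* Monomials of S = K[x_1, ..., x_n] are multi-indices m : 'X_{1..n}; the     *)
(* polynomial is 'X_[m], and variables are numbered from 0.                   *)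

(* [m2s m] lists the indices of the variables of m with multiplicity, in      *)
(* nondecreasing order: i_1 <= ... <= i_d.                                    *)
Definition tspread (n t : nat) (m : 'X_{1..n}) : bool :=
  sorted (fun i j : 'I_n => (i + t <= j)%N) (m2s m).

Definition tspread_monomials (n d t : nat) : {pred 'X_{1..n}} :=
  [pred m : 'X_{1..n} | (mdeg m == d) && tspread t m].
Arguments tspread_monomials : clear implicits.

(* Exponent vectors are compared from the exponent of x_1 on, so that         *)
(* x_1 >_lex x_2 >_lex ... >_lex x_n; the order on 'X_{1..n} provided by the  *)
(* multinomials library compares total degrees first.                         *)
Definition lex_gt (n : nat) (v u : 'X_{1..n}) : bool :=
  ((multinom_val u : n.-tuplelexi nat) < (multinom_val v : n.-tuplelexi nat))%O.

Definition mnm_supp (n : nat) (m : 'X_{1..n}) : {set 'I_n} :=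
  [set i | (0 < m i)%N].

Definition tspread_strongly_stable_set (n d t : nat) (L : {pred 'X_{1..n}}) :
    Prop :=
  {subset L <= tspread_monomials n d t} /\
  forall (u : 'X_{1..n}) (j i : 'I_n),
    u \in L -> j \in mnm_supp u -> (i < j)%N ->
    tspread t (U_(i) + (u - U_(j)))%MM -> (U_(i) + (u - U_(j)))%MM \in L.

Definition tspread_lex_set (n d t : nat) (L : {pred 'X_{1..n}}) : Prop :=
  {subset L <= tspread_monomials n d t} /\
  forall u v : 'X_{1..n},
    u \in L -> v \in tspread_monomials n d t -> lex_gt v u -> v \in L.

Section Ideals.

Variables (K : fieldType) (n : nat).
Implicit Types (I : {pred {mpoly K[n]}}) (t d : nat).

Definition in_generated_ideal (G : {mpoly K[n]} -> Prop) (p : {mpoly K[n]}) :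
    Prop :=
  exists s : seq ({mpoly K[n]} * {mpoly K[n]}),
    (forall ag, ag \in s -> G ag.2) /\ p = \sum_(ag <- s) ag.1 * ag.2.

(* The zero ideal (no generators) and S itself (generated by 1) are included. *)
Definition tspread_monomial_ideal t I : Prop :=
  exists G : 'X_{1..n} -> Prop,
    (forall m, G m -> tspread t m) /\
    forall p, p \in I <->
      in_generated_ideal (fun g => exists2 m, G m & g = 'X_[m]) p.

Definition graded_component I d : {pred {mpoly K[n]}} :=
  [pred p | (p \in I) && (p \is d.-homog)].

Definition tspread_component I d t : {pred 'X_{1..n}} :=
  [pred m : 'X_{1..n} | tspread t m && ('X_[m] \in graded_component I d)].

Definition tspread_strongly_stable_ideal t I : Prop :=
  tspread_monomial_ideal t I /\
  forall d, tspread_strongly_stable_set d t (tspread_component I d t).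

Definition tspread_lex_ideal t I : Prop :=
  tspread_monomial_ideal t I /\
  forall d, tspread_lex_set d t (tspread_component I d t).

(* |[I_d]_t|; the monomials of [I_d]_t all lie in the finite type of          *)
(* monomials of degree < d.+1.                                                *)
Definition card_tspread_component I d t : nat :=
  #|[set m : 'X_{1..n < d.+1} | bmnm m \in tspread_component I d t]|.

(* The entry of index j is f_{t,j-1}(I). The subtraction is never truncated,  *)
(* as [I_j]_t is a subset of [S_j]_t.                                         *)
Definition ft_vector t I (j : nat) : nat :=
  if j is 0 then 1
  else (card_tspread_component predT j t - card_tspread_component I j t)%N.

End Ideals.

(* Main.v *)
(* The core is a t-spread analogue of Bayer's theorem in each degree d: if L is
   lex, M is strongly stable and |L| <= |M|, then for every N there are at most
   as many elements of L as of M supported in the first N variables.  The shadow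
   of either set is obtained by appending one more last index, so sorting it by
   that index turns these inequalities into |Shad L| <= |Shad M|.  Hence the lex
   segments L_d with |L_d| = |[I_d]_t| satisfy Shad L_d <= L_(d+1), and they are
   the t-spread components of the ideal that they generate.

   Bayer's inequality is proved by induction on d, removing one last variable x
   at a time.  If L had more elements avoiding x than M, then L : x would be
   smaller than M : x.  Let y be the lex-first monomial outside L : x and Y the
   lex segment ending at y.  Then |Y| <= |M : x|, so by induction the part of
   Shad Y avoiding x is no larger than that of Shad (M : x), which lies in M.
   Thus some z in L avoiding x is outside Shad Y, so y x precedes z and lies in
   L, contradicting the choice of y. *)
Require Import Defs.
From mathcomp Require Import all_boot all_order all_algebra.
From mathcomp.multinomials Require Import mpoly.
From mathcomp Require Import zify.

Set Implicit Arguments.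
Unset Strict Implicit.
Unset Printing Implicit Defensive.

Import Order.TTheory GRing.Theory.

(** * Index sequences of t-spread monomials *)

Local Notation lexlt u v := ((u : seqlexi nat) < (v : seqlexi nat))%O.
Local Notation lexle u v := ((u : seqlexi nat) <= (v : seqlexi nat))%O.

Lemma lexlt_rcons (u v : seq nat) (i j : nat) : size u = size v ->
  lexlt (rcons u i) (rcons v j) = lexlt u v || (u == v) && (i < j).
Proof.
elim: u v => [|x u IH] [|y v] //= => [_|/succn_inj/IH {}IH].
  by rewrite ltxi_cons !ltxx !leEnat /=; case: ltngtP.
rewrite !ltxi_cons IH eqseq_cons !leEnat.
by case: (ltngtP x y).
Qed.

Lemma sorted_rconsE (T : Type) (e : rel T) s x : transitive e ->
  sorted e (rcons s x) = all (e^~ x) s && sorted e s.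
Proof. by move=> tr; rewrite !(sorted_pairwise tr) pairwise_rcons. Qed.

(* When k < t the truncated k - t is 0, which correctly leaves only w = [::],
   and this only for d' = 0. *)
Fixpoint tseqs (t d N : nat) : seq (seq nat) :=
  if d is d'.+1 then
    (fix extend k := if k is k'.+1 then
       extend k' ++ [seq rcons w k' | w <- tseqs t d' (k - t)] else [::]) N
  else [:: [::]].

Lemma tseqsSS t d N : tseqs t d.+1 N.+1 =
  tseqs t d.+1 N ++ [seq rcons w N | w <- tseqs t d (N.+1 - t)].
Proof. by []. Qed.

Lemma size_tseqs t d N s : s \in tseqs t d N -> size s = d.
Proof.
elim: d N s => [|d IHd] N s; first by rewrite inE => /eqP ->.
elim: N => // N IHN; rewrite tseqsSS mem_cat => /orP[//|/mapP[w /IHd sw ->]].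
by rewrite size_rcons sw.
Qed.

Lemma mem_tseqs_rcons t d N w i :
  (rcons w i \in tseqs t d.+1 N) = (i < N) && (w \in tseqs t d (i.+1 - t)).
Proof.
elim: N => // N IHN; rewrite tseqsSS mem_cat IHN ltnS [i <= N]leq_eqVlt orbC.
apply/orP/andP=> [[/mapP[v vT /rcons_inj[-> ->]]|/andP[-> ->]]|[/predU1P[->|ltiN] wT]].
- by rewrite eqxx.
- by rewrite orbT.
- by left; apply: map_f.
- by right; rewrite ltiN.
Qed.

Lemma mem_tseqs t d N s : (s \in tseqs t d N) =
  [&& size s == d, sorted (fun i j => i + t <= j) s & all (fun i => i < N) s].
Proof.
elim: d N s => [|d IHd] N s; first by rewrite inE; case: s.
case/lastP: s => [|w i].
  by apply/negP => /size_tseqs.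
have tr : transitive (fun i j => i + t <= j) by move=> ? ? ? /=; lia.
rewrite mem_tseqs_rcons IHd size_rcons eqSS all_rcons (sorted_rconsE _ _ tr).
have e1 : all (fun a => a < i.+1 - t) w = all (fun a => a + t <= i) w.
  by apply: eq_all => a; lia.
rewrite e1; apply/andP/and3P => [[iN /and3P[-> -> wi]]|[-> /andP[wi ->] /andP[iN _]]].
  by rewrite wi iN; split=> //; apply: sub_all wi => a /=; lia.
by rewrite wi.
Qed.

Lemma uniq_tseqs t d N : uniq (tseqs t d N).
Proof.
elim: d N => // d IHd; elim=> // N IHN; rewrite tseqsSS cat_uniq IHN /=.
rewrite map_inj_uniq; last by move=> u v /rcons_inj[].
rewrite IHd andbT; apply/hasPn => _ /mapP[w _ ->].
by rewrite mem_tseqs_rcons ltnn.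
Qed.

(** * Counting and ranks in finite lists *)

Lemma count_sub_le (T : eqType) (a b : pred T) (s : seq T) :
  {in s, forall x, a x -> b x} -> count a s <= count b s.
Proof.
move=> ab; rewrite (@eq_in_count _ a (predI a b)); last first.
  by move=> x /ab /=; case: (a x) => // ->.
by apply: sub_count => x /andP[].
Qed.

Lemma count_ltn_ex (T : eqType) (a b : pred T) (s : seq T) :
  count a s < count b s -> exists2 x, x \in s & b x && ~~ a x.
Proof.
move=> lab; apply/hasP; apply: contraLR lab => /hasPn ba.
by rewrite -leqNgt; apply: count_sub_le => x /ba; rewrite negb_and negbK; case: (b x).
Qed.

(** After sorting, the number of entries below [v] is the index of [v], and exactly the first [k]
    entries have index below [k]. *)
Lemma count_rank (disp : Order.disp_t) (T : orderType disp) (s : seq T) k :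
  uniq s -> k <= size s ->
  count (fun v => count (fun w => w < v)%O s < k) s = k.
Proof.
move=> us ks; set r := sort <=%O s.
have pr : perm_eq s r by rewrite perm_sym perm_sort.
have sr : sorted <%O r by rewrite sort_lt_sorted.
have sz : size r = size s by rewrite size_sort.
rewrite (permP pr).
have -> : count (fun v => count (fun w => w < v)%O s < k) r =
          count (fun v => index v r < k) r.
  apply: eq_in_count => v vr; rewrite (permP pr).
  by rewrite -{1}(nth_index v vr) count_lt_nth ?index_mem.
rewrite -{2}[r](cat_take_drop k) count_cat.
have ur : uniq r by rewrite sort_uniq.
rewrite (_ : count _ (take k r) = k); last first.
  transitivity (size (take k r)); last by rewrite size_takel ?sz.
  by apply/eqP; rewrite -all_count; apply/allP => v vt /=; rewrite index_ltn.
rewrite -[RHS]addn0; congr (_ + _); apply/eqP; rewrite -leqn0 leqNgt -has_count.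
apply/hasPn => v vd; rewrite -leqNgt leqNgt; apply/negP => vk.
have vr : v \in r by apply: mem_drop vd.
have : v \in take k r by rewrite in_take.
move=> vt; move: ur; rewrite -{1}[r](cat_take_drop k) cat_uniq => /and3P[_ /hasPn H _].
by have := H v vd; rewrite /= vt.
Qed.

(** * Bayer's inequality *)

(* A smaller sequence is a lex-larger monomial. *)
Definition lexset t d N (L : pred (seq nat)) := forall u v,
  u \in tseqs t d N -> v \in tseqs t d N -> L u -> lexlt v u -> L v.

(** Strong stability for exchanges in place: the new index takes the position of the old one. [M]
    may also hold at unsorted sequences, hence the guards. *)
Definition stable t (M : pred (seq nat)) := forall w i j r,
  M (w ++ j :: r) -> i < j -> sorted (fun a b => a + t <= b) (w ++ j :: r) ->
  sorted (fun a b => a + t <= b) (w ++ i :: r) -> M (w ++ i :: r).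

Lemma tseqs_le t d N N' s : N <= N' -> s \in tseqs t d N -> s \in tseqs t d N'.
Proof.
rewrite !mem_tseqs => le /and3P[-> -> /= /allP H]; apply/allP => x /H /=; lia.
Qed.

Lemma lexset_le t d N N' L : N <= N' -> lexset t d N' L -> lexset t d N L.
Proof. by move=> le lL u v uT vT; apply: lL; apply: tseqs_le le _. Qed.

Definition bayer t d := forall N L M, lexset t d N.+1 L -> stable t M ->
  count L (tseqs t d N.+1) <= count M (tseqs t d N.+1) ->
  count L (tseqs t d N) <= count M (tseqs t d N).

(** For strongly stable [L] this is the full t-spread shadow: if dividing a monomial by some
    variable lands in [L], an exchange shows that dividing by its last variable does too. *)
Definition shadow d (L : pred (seq nat)) : pred (seq nat) := fun s => L (take d s).

Lemma count_shadow t d N L : count (shadow d L) (tseqs t d.+1 N.+1) =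
  count (shadow d L) (tseqs t d.+1 N) + count L (tseqs t d (N.+1 - t)).
Proof.
rewrite tseqsSS count_cat count_map; congr (_ + _); apply: eq_in_count => w wT.
by rewrite /= /shadow -cats1 -(size_tseqs wT) take_size_cat.
Qed.

Lemma bayer_le t d N N' L M : bayer t d -> N <= N' ->
  lexset t d N' L -> stable t M ->
  count L (tseqs t d N') <= count M (tseqs t d N') ->
  count L (tseqs t d N) <= count M (tseqs t d N).
Proof.
move=> bd + + sM; elim: N' => [|N' IH]; first by rewrite leqn0 => /eqP ->.
rewrite leq_eqVlt => /predU1P[-> //|]; rewrite ltnS => le lL cLM.
apply: IH => //; first exact: lexset_le lL.
exact: bd.
Qed.

(** Sorting by the last index [m] writes each size as a sum of counts over prefixes with entries
    below [m.+1 - t]; Bayer's inequality compares the summands. *)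
Lemma shadow_count_le t d N L M : bayer t d ->
  lexset t d (N - t) L -> stable t M ->
  count L (tseqs t d (N - t)) <= count M (tseqs t d (N - t)) ->
  count (shadow d L) (tseqs t d.+1 N) <= count (shadow d M) (tseqs t d.+1 N).
Proof.
move=> bd + sM; elim: N => [//|N IH] lL cLM.
rewrite !count_shadow leq_add //; have le : N - t <= N.+1 - t by lia.
apply: IH; first exact: lexset_le lL.
exact: bayer_le cLM.
Qed.

Lemma ex_min_lex (s : seq (seq nat)) (P : pred (seq nat)) :
  has P s -> exists2 y, (y \in s) && P y & {in s, forall x, P x -> lexle y x}.
Proof.
elim: s => //= x s IH; case: (boolP (has P s)) => [/IH [y /andP[ys Py] Hy] _|nPs].
  case: (boolP (P x && lexlt x y)) => [/andP[Px xy]|nxy].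
    exists x; rewrite ?mem_head // => z; rewrite inE => /predU1P[-> //|zs Pz].
    exact: le_trans (ltW xy) (Hy _ zs Pz).
  exists y; rewrite ?inE ?ys ?orbT // => z; rewrite inE => /predU1P[-> Px|]; last exact: Hy.
  by move: nxy; rewrite Px /= -leNgt.
rewrite orbF => Px; exists x; rewrite ?mem_head // => z; rewrite inE => /predU1P[-> //|zs Pz].
by case/hasP: nPs; exists z.
Qed.

Lemma bayerS t d : bayer t d -> bayer t d.+1.
Proof.
move=> bd N L M lL sM cLM; rewrite leqNgt; apply/negP => ltML.
have srt_rcons w i : sorted (fun a b => a + t <= b) (rcons w i) =
   all (fun a => a + t <= i) w && sorted (fun a b => a + t <= b) w.
  by apply: sorted_rconsE => ? ? ? /=; lia.
pose srt := sorted (fun a b => a + t <= b).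
pose BL : pred (seq nat) := fun w => L (rcons w N).
(* The sortedness clause records that [N] may follow [w]; this lets [BM] inherit stability on
   arbitrary sequences. *)
pose BM : pred (seq nat) := fun w => srt (rcons w N) && M (rcons w N).
have BME : {in tseqs t d (N.+1 - t), BM =1 fun w => M (rcons w N)}.
  move=> w wT; apply: andb_idl => _.
  have : rcons w N \in tseqs t d.+1 N.+1 by rewrite mem_tseqs_rcons ltnSn.
  by rewrite mem_tseqs => /and3P[].
(* Both totals split into sequences avoiding [N] and sequences ending in [N]; an excess of [L] in
   the first kind forces a deficit in the second. *)
have cB : count BL (tseqs t d (N.+1 - t)) < count BM (tseqs t d (N.+1 - t)).
  rewrite (eq_in_count BME); move: cLM.
  rewrite !tseqsSS !count_cat !count_map -/BL => cLM.
  rewrite ltnNge; apply/negP => cBB; move: cLM; apply/negP; rewrite -ltnNge.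
  by rewrite -addSn leq_add.
have sBM : stable t BM.
  move=> w i j r /andP[+ +] ij s1 s2; rewrite !rcons_cat !rcons_cons => s3 m3.
  have s4 : srt (w ++ i :: rcons r N).
    move: s3 s2; rewrite -!rcons_cons -!rcons_cat /srt !srt_rcons => /andP[+ _] ->.
    rewrite !all_cat /= => /and3P[-> ? ->]; rewrite andbT /=; lia.
  by rewrite /BM !rcons_cat !rcons_cons s4 /=; apply: sM m3 _ _ _.
have /ex_min_lex[y /andP[yT nLy] miny] : has (predC BL) (tseqs t d (N.+1 - t)).
  by have [x xT /andP[_ nx]] := count_ltn_ex cB; apply/hasP; exists x.
pose Y : pred (seq nat) := fun u => lexle u y.
have lY N' : lexset t d N' Y by move=> u v _ _ Yu vu; apply: le_trans (ltW vu) Yu.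
(* [Y] lies in [BL] together with [y], and the strict inequality [cB] leaves room for one more
   element. *)
have cY : count Y (tseqs t d (N.+1 - t)) <= count BM (tseqs t d (N.+1 - t)).
  apply: leq_trans cB.
  have := count_predUI BL (pred1 y) (tseqs t d (N.+1 - t)).
  rewrite (count_uniq_mem _ (uniq_tseqs _ _ _)) yT addn1 => <-.
  apply: leq_trans (leq_addr _ _); apply: count_sub_le => u uT Yu /=.
  case: (eqVneq u y) => [_|uy]; first by rewrite orbT.
  rewrite orbF; apply: contraT => /(miny _ uT) yu.
  case/eqP: uy; apply: (@le_anti _ (seqlexi nat)); rewrite yu andbT; exact: Yu.
have cA : count Y (tseqs t d (N - t)) <= count BM (tseqs t d (N - t)).
  by apply: bayer_le cY => //; lia.
have cS := shadow_count_le bd (lY _) sBM cA.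
(* Exchanging the last index [N] of an element of [M] for a smaller [i] stays in [M]. *)
have cSM : count (shadow d BM) (tseqs t d.+1 N) <= count M (tseqs t d.+1 N).
  apply: count_sub_le; case/lastP => [|w i]; first by move=> /size_tseqs.
  move=> wiT; have := wiT; rewrite mem_tseqs_rcons => /andP[iN wT].
  rewrite /shadow -{1}cats1 -(size_tseqs wT) take_size_cat //= => /andP[swN MwN].
  move: MwN wiT swN; rewrite /srt -!cats1 mem_tseqs => MwN /and3P[_ swi _] swN.
  exact: sM MwN _ _ _.
have [z zT /andP[Lz nYz]] := count_ltn_ex (leq_ltn_trans (leq_trans cS cSM) ltML).
have zT' : z \in tseqs t d.+1 N.+1 by apply: tseqs_le zT.
move: z zT zT' Lz nYz; case/lastP => [/size_tseqs //|z i] + zT Lz.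
rewrite mem_tseqs_rcons => /andP[iN z'T].
have yN : rcons y N \in tseqs t d.+1 N.+1 by rewrite mem_tseqs_rcons ltnSn.
(* The prefix of [z] comes after [y], so [rcons y N] precedes [z] whatever the last indices are. *)
rewrite /shadow -cats1 -(size_tseqs z'T) take_size_cat // /Y -ltNge => yz.
move: nLy; rewrite /= /BL (lL _ _ zT yN Lz) //.
by rewrite lexlt_rcons ?yz // (size_tseqs yT) (size_tseqs z'T).
Qed.

Lemma bayer_all t d : bayer t d.
Proof. by elim: d => [//|d]; apply: bayerS. Qed.

(** * Lex segments and their shadows *)

Definition lexseg t n d k : pred (seq nat) := fun s =>
  count (fun w => lexlt w s) (tseqs t d n) < k.

Lemma lexseg_lt t n d k u v : lexseg t n d k u -> lexlt v u -> lexseg t n d k v.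
Proof.
move=> uk vu; apply: leq_ltn_trans uk; apply: sub_count => w /= wv.
exact: lt_trans vu.
Qed.

Lemma lexseg_le t n d k u v : lexseg t n d k u -> lexle v u -> lexseg t n d k v.
Proof. by move=> uk; rewrite le_eqVlt => /predU1P[-> //|]; apply: lexseg_lt. Qed.

Lemma count_lexseg t n d k : k <= size (tseqs t d n) ->
  count (lexseg t n d k) (tseqs t d n) = k.
Proof. exact: (@count_rank _ (seqlexi nat) _ _ (uniq_tseqs t d n)). Qed.

(** Sequences up to [s] have prefixes up to [take d s], so they lie in the shadow of the lex segment
    [L]. That shadow is at most as large as the shadow of [M], hence as [M'], which bounds the rank
    of [s]. *)
Lemma lexseg_shadow t n d (M M' : pred (seq nat)) s : stable t M ->
  {in tseqs t d.+1 n, forall u, shadow d M u -> M' u} ->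
  s \in tseqs t d.+1 n ->
  lexseg t n d (count M (tseqs t d n)) (take d s) ->
  lexseg t n d.+1 (count M' (tseqs t d.+1 n)) s.
Proof.
move=> sM MM' sT; set L := lexseg _ _ _ _ => Ls.
have cL : count L (tseqs t d n) = count M (tseqs t d n).
  by apply: count_lexseg; apply: count_size.
have lL : lexset t d n L by move=> u v _ _; apply: lexseg_lt.
have le : n - t <= n by apply: leq_subr.
have cLM : count L (tseqs t d (n - t)) <= count M (tseqs t d (n - t)).
  apply: bayer_le (le) lL sM _; [exact: bayer_all | by rewrite cL].
have := shadow_count_le (@bayer_all t d) (lexset_le le lL) sM cLM.
move/leq_trans/(_ (count_sub_le MM')); apply: leq_trans.
(* Counting [s] along with its predecessors turns the strict bound into a non-strict one. *)
rewrite -addn1 -[X in _ + X](_ : count (pred1 s) (tseqs t d.+1 n) = _); last first.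
  by rewrite count_uniq_mem ?uniq_tseqs // sT.
rewrite -count_predUI [X in _ + X](eq_count (a2 := pred0)) ?count_pred0 ?addn0; last first.
  by move=> w /=; case: eqP => [->|]; rewrite ?ltxx ?andbF.
apply: count_sub_le => w wT /orP[ws|/eqP-> //]; apply: lexseg_le Ls _.
move: ws sT wT; case/lastP: s => [_ /size_tseqs //|s i].
case/lastP: w => [_ _ /size_tseqs //|w j] ws.
rewrite !mem_tseqs_rcons => /andP[_ /size_tseqs sd] /andP[_ /size_tseqs wd].
rewrite -!cats1 !take_size_cat //; move: ws; rewrite lexlt_rcons ?sd //.
by case/orP => [/ltW //|/andP[/eqP->]].
Qed.

Lemma take_tseqs t d n e s : e <= d -> s \in tseqs t d n -> take e s \in tseqs t e n.
Proof.
move=> ed; rewrite !mem_tseqs => /and3P[/eqP sd ss sn].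
rewrite size_takel ?sd // eqxx take_sorted //=.
by apply/allP => x /mem_take /(allP sn).
Qed.

(* The first variables of a squarefree monomial form its lex-largest divisor of
   given degree. *)
Lemma take_le_subseq (w s : seq nat) : sorted ltn s -> subseq w s ->
  lexle (take (size w) s) w.
Proof.
elim: s w => [|x s IH] [|y w] //= ss; have s' := path_sorted ss.
rewrite lexi_cons !leEnat; case: eqP => [-> /(IH _ s') -> | _ sub].
  by rewrite leqnn implybT.
have : x < y.
  move: ss; rewrite (path_sortedE ltn_trans) => /andP[/allP H _].
  by apply: H; apply: (mem_subseq sub); rewrite mem_head.
by case: ltngtP.
Qed.

Lemma lexseg_chain t n (M : nat -> pred (seq nat)) e d s :
  (forall d, stable t (M d)) ->
  (forall d, {in tseqs t d.+1 n, forall u, shadow d (M d) u -> M d.+1 u}) ->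
  e <= d -> s \in tseqs t d n ->
  lexseg t n e (count (M e) (tseqs t e n)) (take e s) ->
  lexseg t n d (count (M d) (tseqs t d n)) s.
Proof.
move=> sM shM; elim: d => [|d IH] in s *.
  by rewrite leqn0 => /eqP -> /size_tseqs sd; rewrite take_oversize ?sd.
rewrite leq_eqVlt => /predU1P[-> sT|]; first by rewrite take_oversize ?(size_tseqs sT).
rewrite ltnS => ed sT es; apply: (lexseg_shadow (sM d) (@shM d)) => //.
by apply: IH => //; rewrite ?take_takel //; apply: take_tseqs sT.
Qed.

(** * Dictionary between monomials and index sequences *)

Section Indices.
Variables (n : nat).
Implicit Types (m u v : 'X_{1..n}) (s : seq nat).

Definition idx m : seq nat := [seq val i | i <- m2s m].
Definition mon s : 'X_{1..n} := [multinom count_mem (val i) s | i < n].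

Lemma size_idx m : size (idx m) = mdeg m.
Proof. by rewrite size_map size_m2s. Qed.

Lemma tspread_idx t m : tspread t m = sorted (fun i j => i + t <= j) (idx m).
Proof. by rewrite /idx sorted_map. Qed.

Lemma idx_tseqs t m : tspread t m = (idx m \in tseqs t (mdeg m) n).
Proof.
have idxn : all (fun i => i < n) (idx m).
  by apply/allP => _ /mapP[i _ ->]; apply: ltn_ord.
by rewrite mem_tseqs size_idx eqxx tspread_idx idxn andbT.
Qed.

Lemma count_idx m (i : 'I_n) : count_mem (val i) (idx m) = m i.
Proof.
rewrite -[m in RHS]s2mK mnmE count_map; apply: eq_count => j /=.
by rewrite (inj_eq val_inj).
Qed.

Lemma idxK : cancel idx mon.
Proof. by move=> m; apply/mnmP => i; rewrite mnmE count_idx. Qed.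

Lemma monK s : sorted leq s -> all (fun i => i < n) s -> idx (mon s) = s.
Proof.
move=> ss /allP sn; apply: (sorted_eq leq_trans anti_leq) => //.
  by have := srt_m2s (mon s); rewrite /idx.
apply/allP => x _; apply/eqP; case: (ltnP x n) => xn.
  by rewrite -[x]/(val (Ordinal xn)) count_idx mnmE.
rewrite !(count_memPn _) //; apply/negP.
  by move/sn; rewrite ltnNge xn.
by case/mapP => i _ xi; move: xn; rewrite xi leqNgt ltn_ord.
Qed.

Lemma tseqs_monK t d s : s \in tseqs t d n -> idx (mon s) = s.
Proof.
rewrite mem_tseqs => /and3P[_ ss sn]; apply: monK => //.
by apply: sub_sorted ss => i j; apply: leq_trans; apply: leq_addr.
Qed.

Lemma mdeg_mon t d s : s \in tseqs t d n -> mdeg (mon s) = d.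
Proof. by move=> sT; rewrite -size_idx (tseqs_monK sT) (size_tseqs sT). Qed.

Lemma tspread_mon t d s : s \in tseqs t d n -> tspread t (mon s).
Proof. by move=> sT; rewrite idx_tseqs (tseqs_monK sT) (mdeg_mon sT). Qed.

Lemma subseq_idx u v : (u <= v)%MM -> subseq (idx u) (idx v).
Proof.
move/mnm_lepP => uv; apply: map_subseq; rewrite /m2s.
elim: (enum _) => //= i r IH; apply: cat_subseq => //.
by rewrite -(subnK (uv i)) nseqD suffix_subseq.
Qed.

End Indices.

(** * The lex order on exponent vectors and on index sequences *)

(* Exponent vectors to index sequences, numbering the variables from k. *)
Fixpoint expand k (a : seq nat) :=
  if a is x :: a' then nseq x k ++ expand k.+1 a' else [::].

Lemma expand_ge k a : all (leq k) (expand k a).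
Proof.
elim: a k => //= x a IH k; rewrite all_cat all_nseq leqnn orbT /=.
by apply: sub_all (IH k.+1) => i; apply: ltnW.
Qed.

Lemma size_expand k a : size (expand k a) = sumn a.
Proof. by elim: a k => //= x a IH k; rewrite size_cat size_nseq IH. Qed.

Lemma lexlt_cat2l (p u v : seq nat) : lexlt (p ++ u) (p ++ v) = lexlt u v.
Proof. by elim: p => //= x p IH; rewrite ltxi_cons lexx IH. Qed.

(** At the first differing exponent, the vector with the larger one still lists that variable where
    the other has moved on to a later one. *)
Lemma lexlt_expand k a b : size a = size b -> sumn a = sumn b ->
  lexlt a b -> lexlt (expand k b) (expand k a).
Proof.
elim: a b k => [|x a IH] [|y b] k //= /succn_inj sab sumab.
rewrite ltxi_cons !leEnat => /andP[].
rewrite leq_eqVlt => /predU1P[xy|xy _].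
  rewrite xy leqnn lexlt_cat2l => ab; apply: IH => //.
  by move: sumab; rewrite xy => /addnI.
rewrite -(subnKC xy) addSnnS nseqD -catA lexlt_cat2l /=.
have := expand_ge k.+1 a; have := size_expand k.+1 a.
(* Equal degrees exclude the empty case: [a] must still make up for the larger exponent [y]. *)
case: (expand k.+1 a) => [|z e] /=; first by lia.
by move=> _ /andP[kz _]; rewrite ltxi_cons !leEnat (ltnW kz) leqNgt kz.
Qed.

Lemma idx_expand n (m : 'X_{1..n}) : idx m = expand 0 (multinom_val m).
Proof.
have expand_iota f k l : expand k [seq f i | i <- iota k l] =
    flatten [seq nseq (f i) i | i <- iota k l].
  by elim: l k => //= l IH k; rewrite IH.
have -> : multinom_val m = [seq nth 0 (multinom_val m) i | i <- iota 0 n] :> seq nat.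
  by rewrite map_nth_iota0 ?size_tuple // take_oversize ?size_tuple.
rewrite expand_iota -val_enum_ord -map_comp /idx /m2s map_flatten -map_comp.
congr flatten; apply: eq_map => i /=; rewrite map_nseq.
by rewrite /fun_of_multinom (tnth_nth 0).
Qed.

Lemma lex_gt_idx n (u v : 'X_{1..n}) : mdeg u = mdeg v -> lex_gt v u ->
  lexlt (idx v) (idx u).
Proof.
move=> duv vu; rewrite !idx_expand; apply: lexlt_expand => //.
  by rewrite !size_tuple.
by rewrite -!(size_expand 0) -!idx_expand !size_idx.
Qed.

Local Open Scope ring_scope.

(** * Ideals and their t-spread components *)

Section MonomialIdeals.
Variables (K : fieldType) (n t : nat).
Implicit Types (I : {pred {mpoly K[n]}}) (m u v : 'X_{1..n}).

Lemma mem_component I d m :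
  (m \in tspread_component I d t) = [&& tspread t m, 'X_[m] \in I & mdeg m == d].
Proof. by rewrite !inE dhomogX. Qed.

Definition mons I : pred (seq nat) := fun s => 'X_[mon n s] \in I.

Lemma card_component I d :
  card_tspread_component I d t = count (mons I) (tseqs t d n).
Proof.
rewrite /card_tspread_component cardE -size_filter.
rewrite -(size_map (fun b : 'X_{1..n < d.+1} => idx (bmnm b))).
apply/perm_size/uniq_perm.
- rewrite map_inj_uniq ?enum_uniq // => a b /(can_inj (@idxK n)); exact: val_inj.
- exact/filter_uniq/uniq_tseqs.
move=> s; rewrite mem_filter; apply/mapP/andP => [[b + ->]|[sI sT]].
  rewrite mem_enum inE mem_component => /and3P[tb bI /eqP db].
  by move: tb; rewrite /mons idxK bI idx_tseqs db.
have dm : (mdeg (mon n s) < d.+1)%N by rewrite (mdeg_mon sT).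
exists (BMultinom dm); last by rewrite /= (tseqs_monK sT).
by rewrite mem_enum inE mem_component /= (tspread_mon sT) (mdeg_mon sT) eqxx andbT.
Qed.

Lemma monomial_idealM I (p q : {mpoly K[n]}) :
  tspread_monomial_ideal t I -> p \in I -> q * p \in I.
Proof.
case=> G [_ IG] /IG[s [sG ->]]; apply/IG; exists [seq (q * ag.1, ag.2) | ag <- s].
split=> [_ /mapP[ag /sG + ->] //|].
by rewrite big_map mulr_sumr; apply: eq_bigr => ag _; rewrite mulrA.
Qed.

Lemma mon_rcons (s : seq nat) (i : 'I_n) : mon n (rcons s i) = (U_(i) + mon n s)%MM.
Proof.
by apply/mnmP => j; rewrite mnmDE mnm1E !mnmE -cats1 count_cat /= addn0 addnC.
Qed.

Lemma mons_shadow I d : tspread_monomial_ideal t I ->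
  {in tseqs t d.+1 n, forall s, shadow d (mons I) s -> mons I s}.
Proof.
move=> mI s; case/lastP: s => [/size_tseqs //|s i].
rewrite mem_tseqs_rcons => /andP[ltin sT].
rewrite /shadow /mons -{1}cats1 -(size_tseqs sT) take_size_cat // => sI.
rewrite -[i]/(val (Ordinal ltin)) mon_rcons mpolyXD.
exact: monomial_idealM mI sI.
Qed.

(** Restricted to genuine t-spread sequences of degree [d], because [stable] quantifies over all
    sequences and [mon] ignores entries from [n] on. *)
Definition monsT I d : pred (seq nat) := [pred s in tseqs t d n | mons I s].

Lemma stable_monsT I d : tspread_strongly_stable_ideal t I -> stable t (monsT I d).
Proof.
case=> _ /(_ d)[_ stab] w i j r /andP[sT sI] ltij _ si.
have sT' : w ++ i :: r \in tseqs t d n.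
  move: sT; rewrite !mem_tseqs si !size_cat !all_cat /=.
  by case/and3P => -> _ /and3P[-> jn ->]; rewrite (ltn_trans ltij).
rewrite /monsT /= sT' /=.
have jn : (j < n)%N by move: sT; rewrite mem_tseqs all_cat /=; case/and4P => _ _ _ /andP[].
pose oi := Ordinal (ltn_trans ltij jn); pose oj := Ordinal jn.
have E : mon n (w ++ i :: r) = (U_(oi) + (mon n (w ++ j :: r) - U_(oj)))%MM.
  apply/mnmP => k; rewrite mnmDE mnmBE !mnm1E !mnmE !count_cat /=.
  rewrite -(inj_eq val_inj oi k) -(inj_eq val_inj oj k) /=; lia.
have /stab : mon n (w ++ j :: r) \in tspread_component I d t.
  rewrite mem_component (tspread_mon sT) (mdeg_mon sT) eqxx andbT; exact: sI.
move/(_ oj oi); rewrite -E (tspread_mon sT') mem_component => H.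
have js : oj \in mnm_supp (mon n (w ++ j :: r)).
  by rewrite inE mnmE count_cat /= eqxx addnCA.
by case/and3P: (H js ltij isT).
Qed.

(** Divisors of [m] have degree at most [mdeg m], so a finite search makes the ideal a boolean
    predicate. *)
Definition monomial_span_ideal (L : pred 'X_{1..n}) : {pred {mpoly K[n]}} :=
  [pred p | all (fun m => [exists v : 'X_{1..n < (mdeg m).+1},
                             L (bmnm v) && (bmnm v <= m)%MM]) (msupp p)].

Lemma span_idealP (L : pred 'X_{1..n}) p :
  reflect (forall m, m \in msupp p -> exists2 v, L v & (v <= m)%MM)
          (p \in monomial_span_ideal L).
Proof.
apply: (iffP allP) => H m /H.
  by case/existsP => v /andP[Lv vm]; exists (bmnm v).
case=> v Lv vm; apply/existsP.
have dv : (mdeg v < (mdeg m).+1)%N by rewrite ltnS -(submK vm) mdegD leq_addl.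
by exists (BMultinom dv); rewrite /= Lv.
Qed.

Lemma span_idealX (L : pred 'X_{1..n}) m :
  reflect (exists2 v, L v & (v <= m)%MM) ('X_[m] \in monomial_span_ideal L).
Proof.
apply: (iffP (span_idealP _ _)) => [|H u]; first by apply; rewrite msuppX mem_head.
by rewrite msuppX inE => /eqP ->.
Qed.

Lemma span_ideal_monomial (L : pred 'X_{1..n}) :
  (forall v, L v -> tspread t v) -> tspread_monomial_ideal t (monomial_span_ideal L).
Proof.
move=> Lt; exists L; split=> // p; split=> [/span_idealP pL|[s [sL ->]]].
  rewrite [p]mpolyE; elim: (msupp p) pL => [_|m r IH pL].
    by exists [::]; rewrite !big_nil.
  have [|s [sL sr]] := IH; first by move=> u ur; apply: pL; rewrite inE ur orbT.
  have [v Lv vm] := pL m (mem_head _ _).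
  exists ((p@_m *: 'X_[m - v], 'X_[v]) :: s); split=> [ag|].
    by rewrite inE => /predU1P[->|/sL //]; exists v.
  by rewrite !big_cons sr /= -scalerAl -mpolyXD submK.
elim: s sL => [_|[a g] s IH sL].
  by rewrite big_nil; apply/span_idealP => m; rewrite msupp0.
have /span_idealP IHs : \sum_(ag <- s) ag.1 * ag.2 \in monomial_span_ideal L.
  by apply: IH => ag ags; apply: sL; rewrite inE ags orbT.
rewrite big_cons /=; have [/= v Lv ->] := sL _ (mem_head _ _).
apply/span_idealP => m /msuppD_le; rewrite mem_cat => /orP[|/IHs //].
rewrite (perm_mem (msuppMX _ _)) => /mapP[u _ ->]; exists v => //.
exact: lem_addr.
Qed.

End MonomialIdeals.

Theorem theorem2p1 (K : fieldType) (n t : nat) (ht : (1 <= t)%N)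
    (I : {pred {mpoly K[n]}}) (hI : tspread_strongly_stable_ideal t I) :
  exists J : {pred {mpoly K[n]}},
    tspread_lex_ideal t J /\ ft_vector t J =1 ft_vector t I.
Proof.
pose k d := count (monsT t I d) (tseqs t d n).
have kE d : k d = card_tspread_component I d t.
  by rewrite card_component; apply: eq_in_count => s sT; rewrite /monsT /= sT.
pose L (m : 'X_{1..n}) := tspread t m && lexseg t n (mdeg m) (k (mdeg m)) (idx m).
pose J := @monomial_span_ideal K n L.
have Jmon : tspread_monomial_ideal t J by apply: span_ideal_monomial => v /andP[].
(* Multiples of the chosen monomials add no t-spread monomial outside the lex segments. *)
have JX m : tspread t m -> ('X_[m] \in J) = L m.
  move=> tm; apply/span_idealX/idP => [[v /andP[tv Lv] vm]|Lm]; last first.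
    by exists m => //; apply: lepm_refl.
  rewrite /L tm /=.
  have dvm : (mdeg v <= mdeg m)%N by rewrite -(submK vm) mdegD leq_addl.
  (* The first [mdeg v] indices of [m] form a sequence lex-below or equal to that of [v], hence in
     its segment; the chain lifts this to degree [mdeg m]. *)
  apply: (lexseg_chain (M := monsT t I) _ _ dvm); rewrite -?idx_tseqs //.
  - by move=> d; apply: stable_monsT.
  - move=> d s sT /andP[_ sI]; rewrite /monsT /= sT.
    exact: (mons_shadow (proj1 hI) sT sI).
  - apply: lexseg_le Lv _; rewrite -size_idx; apply: take_le_subseq.
      (* Here [1 <= t] makes the index sequence strictly increasing. *)
      move: tm; rewrite tspread_idx; apply: sub_sorted => i j.
      by apply: leq_trans; rewrite -addn1 leq_add2l.
    exact: subseq_idx.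
exists J; split; first split=> // d.
  split=> [m|u v]; first by rewrite mem_component => /and3P[tm _ dm]; rewrite inE dm tm.
  rewrite !mem_component => /and3P[tu uJ /eqP du]; rewrite inE => /andP[/eqP dv tv] vu.
  rewrite tv dv eqxx andbT JX //=; move: uJ; rewrite JX // /L tu tv du dv /=.
  by move/lexseg_lt; apply; apply: lex_gt_idx => //; rewrite du.
case=> //= d; congr (_ - _)%N; rewrite -kE card_component.
rewrite -[RHS](@count_lexseg t n d.+1) ?count_size //.
apply: eq_in_count => s sT; rewrite /mons JX ?(tspread_mon sT) //.
by rewrite /L (tspread_mon sT) (mdeg_mon sT) (tseqs_monK sT).
Qed.
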